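(* Let $\Gamma$ be a simple graph (with a possibly infinite vertex set) and, for each vertex $v$ of $\Gamma$, let $G_v$ be a sofic group. Then the graph product of the groups $G_v$ with respect to $\Gamma$ is sofic.
   Context: Graph product: given a simple graph $\Gamma$ and a group $G_v$ for each vertex $v$ of $\Gamma$, the graph product of the groups $G_v$ with respect to $\Gamma$ is the quotient of the free product of all the $G_v$ by the normal closure of the commutators $[g_v,g_w]$ for all $g_v\in G_v$, $g_w\in G_w$ with $\{v,w\}$ an edge of $\Gamma$. For a finite nonempty set $A$, let $\mathcal{S}(A)$ be the group of all permutations of $A$, acting on the right (so in a product $f_1f_2$ the permutation $f_1$ is applied first). For $\epsilon>0$, two elements $f_1,f_2\in\mathcal{S}(A)$ are $\epsilon$-similar if the number of $a\in A$ with $f_1(a)\neq f_2(a)$ is at most $\epsilon|A|$. Let $G$ be a group, $\epsilon>0$ a real number and $F\subseteq G$ a finite subset. A special $(F,\epsilon)$-quasi-action of $G$ on a finite nonempty set $A$ is a function $\phi:G\to\mathcal{S}(A)$ such that: (a) $\phi(1)=1$; (b) $\phi(g)^{-1}=\phi(g^{-1})$ for all $g\in G$; (c) for every $g\in F\setminus\{1\}$, $\phi(g)$ has no fixed points; (d) for all $g_1,g_2\in F$, $\phi(g_1g_2)$ is $\epsilon$-similar to $\phi(g_1)\phi(g_2)$. A group $G$ is sofic if for every $\epsilon\in(0,1)$ and every finite subset $F\subseteq G$, $G$ admits a special $(F,\epsilon)$-quasi-action on some finite nonempty set. *)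

(* Defs.v *)
From HB Require Import structures.
From mathcomp Require Import all_boot all_order all_algebra perm.
From mathcomp Require Import all_classical all_reals.

Set Implicit Arguments.
Unset Strict Implicit.
Unset Printing Implicit Defensive.

Local Open Scope classical_set_scope.
Local Open Scope group_scope.
Local Open Scope quotient_scope.

(* Groups are [groupType]s (possibly infinite).  A [groupType] carries a
   [choiceType] structure, which every type has by [gen_choiceMixin]. *)

Record simple_graph := SimpleGraph {
  vertex :> Type ;
  adj : vertex -> vertex -> Prop ;
  adj_sym : forall v w, adj v w -> adj w v ;
  adj_irrefl : forall v, ~ adj v v }.

(* Free product: words in the disjoint union of the groups, modulo the
   congruence generated by deleting identity letters and multiplying adjacent
   letters of the same group. *)

Section FreeProduct.
Variables (V : Type) (G : V -> groupType).

Definition word : Type := seq {v : V & G v}.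

HB.instance Definition _ := gen_eqMixin word.
HB.instance Definition _ := gen_choiceMixin word.

Definition letter (v : V) (g : G v) : {v : V & G v} :=
  existT (fun v => G v : Type) v g.

Inductive word_eq : word -> word -> Prop :=
| word_eq_refl s : word_eq s s
| word_eq_sym s t : word_eq s t -> word_eq t s
| word_eq_trans s t u : word_eq s t -> word_eq t u -> word_eq s u
| word_eq1 s t v : word_eq (s ++ letter (1 : G v) :: t) (s ++ t)
| word_eqM s t v (g h : G v) :
    word_eq (s ++ letter g :: letter h :: t) (s ++ letter (g * h) :: t).

Definition word_eqb : rel word := fun s t => `[< word_eq s t >].

Lemma word_eqb_refl : reflexive word_eqb.
Proof. by move=> s; apply/asboolP; apply: word_eq_refl. Qed.

Lemma word_eqb_sym : symmetric word_eqb.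
Proof.
by move=> s t; apply/asboolP/asboolP => st; apply: word_eq_sym.
Qed.

Lemma word_eqb_trans : transitive word_eqb.
Proof.
move=> t s u /asboolP st /asboolP tu; apply/asboolP.
exact: word_eq_trans st tu.
Qed.

Canonical word_equiv := EquivRel word_eqb
  word_eqb_refl word_eqb_sym word_eqb_trans.

Definition free_product : Type := {eq_quot word_equiv}.

HB.instance Definition _ := Choice.on free_product.
HB.instance Definition _ := EqQuotient.on free_product.

Lemma free_productP (s t : word) :
  reflect (word_eq s t) (\pi_free_product s == \pi_free_product t).
Proof. by rewrite piE; apply: asboolP. Qed.

Lemma word_eq_catl (u s t : word) : word_eq s t -> word_eq (u ++ s) (u ++ t).
Proof.
elim=> {s t} [s|s t _|s t w _ st _|s t v|s t v g h].
- exact: word_eq_refl.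
- exact: word_eq_sym.
- exact: word_eq_trans.
- by rewrite !catA; apply: word_eq1.
- by rewrite !catA; apply: word_eqM.
Qed.

Lemma word_eq_catr (u s t : word) : word_eq s t -> word_eq (s ++ u) (t ++ u).
Proof.
elim=> {s t} [s|s t _|s t w _ st _|s t v|s t v g h].
- exact: word_eq_refl.
- exact: word_eq_sym.
- exact: word_eq_trans.
- by rewrite -!catA; apply: word_eq1.
- by rewrite -!catA; apply: word_eqM.
Qed.

Lemma word_eq_cat (s s' t t' : word) :
  word_eq s s' -> word_eq t t' -> word_eq (s ++ t) (s' ++ t').
Proof.
move=> ss' tt'.
exact: word_eq_trans (word_eq_catr t ss') (word_eq_catl s' tt').
Qed.

Definition word_inv (s : word) : word :=
  rev [seq @letter (projT1 x) (projT2 x)^-1 | x : {v : V & G v} <- s].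

Lemma word_inv_cat (s t : word) :
  word_inv (s ++ t) = word_inv t ++ word_inv s.
Proof. by rewrite /word_inv map_cat rev_cat. Qed.

Lemma word_inv_cons v (g : G v) (s : word) :
  word_inv (letter g :: s) = word_inv s ++ [:: letter g^-1].
Proof. by rewrite /word_inv /= rev_cons cats1. Qed.

Lemma word_eq_inv (s t : word) :
  word_eq s t -> word_eq (word_inv s) (word_inv t).
Proof.
elim=> {s t} [s|s t _|s t w _ st _|s t v|s t v g h].
- exact: word_eq_refl.
- exact: word_eq_sym.
- exact: word_eq_trans.
- rewrite !word_inv_cat word_inv_cons -catA /= invg1.
  exact: word_eq1.
- rewrite !word_inv_cat !word_inv_cons -!catA /= invgM.
  exact: word_eqM.
Qed.

Lemma word_eqV (s : word) : word_eq (word_inv s ++ s) [::].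
Proof.
elim: s => [|[v g] s IHs]; first exact: word_eq_refl.
rewrite (word_inv_cons g) -catA /=; apply: word_eq_trans IHs.
apply: word_eq_trans (word_eqM _ _ _ _) _; rewrite mulVg.
exact: word_eq1.
Qed.

Lemma word_invK : involutive word_inv.
Proof.
move=> s; rewrite /word_inv map_rev revK -map_comp.
by rewrite -[RHS]map_id; apply: eq_map => -[v g] /=; rewrite invgK.
Qed.

Lemma pi_repr (s : word) : word_eq (repr (\pi_free_product s)) s.
Proof. by apply/free_productP; rewrite reprK. Qed.

Definition fp_mul (x y : free_product) : free_product :=
  \pi_free_product (repr x ++ repr y).
Definition fp_one : free_product := \pi_free_product ([::] : word).
Definition fp_inv (x : free_product) : free_product :=
  \pi_free_product (word_inv (repr x)).

Lemma fp_mulE (s t : word) :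
  fp_mul (\pi_free_product s) (\pi_free_product t) =
  \pi_free_product (s ++ t).
Proof. by apply/eqP/free_productP; apply: word_eq_cat; apply: pi_repr. Qed.

Lemma fp_invE (s : word) :
  fp_inv (\pi_free_product s) = \pi_free_product (word_inv s).
Proof. by apply/eqP/free_productP; apply: word_eq_inv; apply: pi_repr. Qed.

Lemma fp_mulA : associative fp_mul.
Proof.
elim/quotW=> s; elim/quotW=> t; elim/quotW=> u.
by rewrite (fp_mulE t u) (fp_mulE s t) (fp_mulE s) (fp_mulE _ u) catA.
Qed.

Lemma fp_mul1 : left_id fp_one fp_mul.
Proof. by elim/quotW=> s; rewrite (fp_mulE [::] s). Qed.

Lemma fp_mulr1 : right_id fp_one fp_mul.
Proof. by elim/quotW=> s; rewrite (fp_mulE s [::]) cats0. Qed.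

Lemma fp_mulV : left_inverse fp_one fp_inv fp_mul.
Proof.
elim/quotW=> s; rewrite (fp_invE s) (fp_mulE _ s).
exact/eqP/free_productP/word_eqV.
Qed.

Lemma fp_mulrV : right_inverse fp_one fp_inv fp_mul.
Proof.
elim/quotW=> s; rewrite (fp_invE s) (fp_mulE s).
apply/eqP/free_productP; rewrite -{1}[s]word_invK.
exact: word_eqV.
Qed.

HB.instance Definition _ := isGroup.Build free_product
  fp_mulA fp_mul1 fp_mulr1 fp_mulV fp_mulrV.

Definition fp_incl (v : V) (g : G v) : free_product :=
  \pi_free_product ([:: letter g] : word).

Lemma fp_inclM (v : V) : {morph @fp_incl v : g h / g * h}.
Proof.
move=> g h; rewrite /fp_incl [RHS](fp_mulE [:: letter g] [:: letter h]); apply/eqP/free_productP.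
exact: word_eq_sym (word_eqM [::] [::] g h).
Qed.

End FreeProduct.

Section NormalSubgroup.
Variable G : groupType.

Record normal_subgroup := NormalSubgroup {
  nsub_set :> set G ;
  nsub1 : nsub_set 1 ;
  nsubM : forall x y, nsub_set x -> nsub_set y -> nsub_set (x * y) ;
  nsubV : forall x, nsub_set x -> nsub_set x^-1 ;
  nsubJ : forall x y, nsub_set x -> nsub_set (x ^ y) }.

Definition nclosure_set (S : set G) : set G :=
  [set x | forall N : normal_subgroup, S `<=` N -> nsub_set N x].

Lemma nclosure1 S : nclosure_set S 1.
Proof. by move=> N _; apply: nsub1. Qed.

Lemma nclosureM S x y :
  nclosure_set S x -> nclosure_set S y -> nclosure_set S (x * y).
Proof. by move=> Sx Sy N SN; apply: nsubM; [apply: Sx|apply: Sy]. Qed.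

Lemma nclosureV S x : nclosure_set S x -> nclosure_set S x^-1.
Proof. by move=> Sx N SN; apply/nsubV/Sx. Qed.

Lemma nclosureJ S x y : nclosure_set S x -> nclosure_set S (x ^ y).
Proof. by move=> Sx N SN; apply/nsubJ/Sx. Qed.

Definition normal_closure (S : set G) : normal_subgroup :=
  NormalSubgroup (@nclosure1 S) (@nclosureM S) (@nclosureV S) (@nclosureJ S).

End NormalSubgroup.

Section QuotientGroup.
Variables (G : groupType) (N : normal_subgroup G).

Definition coset_eqb : rel G := fun x y => `[< nsub_set N (x^-1 * y) >].

Lemma coset_eqb_refl : reflexive coset_eqb.
Proof. by move=> x; apply/asboolP; rewrite mulVg; apply: nsub1. Qed.

Lemma coset_eqb_sym : symmetric coset_eqb.
Proof.
by move=> x y; apply/asboolP/asboolP => /nsubV; rewrite invgM invgK.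
Qed.

Lemma coset_eqb_trans : transitive coset_eqb.
Proof.
move=> y x z /asboolP xy /asboolP yz; apply/asboolP.
by have := nsubM xy yz; rewrite mulgA mulgK.
Qed.

Canonical coset_equiv := EquivRel coset_eqb
  coset_eqb_refl coset_eqb_sym coset_eqb_trans.

Definition quotient_group : Type := {eq_quot coset_equiv}.

HB.instance Definition _ := Choice.on quotient_group.
HB.instance Definition _ := EqQuotient.on quotient_group.

Lemma quotient_groupP (x y : G) :
  reflect (nsub_set N (x^-1 * y)) (\pi_quotient_group x == \pi_quotient_group y).
Proof. by rewrite piE; apply: asboolP. Qed.

Lemma pi_repr_coset (x : G) :
  nsub_set N ((repr (\pi_quotient_group x))^-1 * x).
Proof. by apply/quotient_groupP; rewrite reprK. Qed.

Definition qg_mul (x y : quotient_group) : quotient_group :=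
  \pi_quotient_group (repr x * repr y).
Definition qg_one : quotient_group := \pi_quotient_group (1 : G).
Definition qg_inv (x : quotient_group) : quotient_group :=
  \pi_quotient_group ((repr x)^-1).

Lemma qg_mulE (x y : G) :
  qg_mul (\pi_quotient_group x) (\pi_quotient_group y) = \pi_quotient_group (x * y).
Proof.
apply/eqP/quotient_groupP; have := pi_repr_coset x; have := pi_repr_coset y.
move: (repr _) (repr _) => y' x' Ny /(nsubJ y) Nx.
by have := nsubM Ny Nx; rewrite /conjg invgM !mulgA mulgK.
Qed.

Lemma qg_invE (x : G) :
  qg_inv (\pi_quotient_group x) = \pi_quotient_group x^-1.
Proof.
apply/eqP/quotient_groupP; have := pi_repr_coset x.
move: (repr _) => x' /nsubV /(nsubJ x'^-1).
by rewrite /conjg invgM !invgK !mulgA mulgK.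
Qed.

Lemma qg_mulA : associative qg_mul.
Proof.
elim/quotW=> x; elim/quotW=> y; elim/quotW=> z.
by rewrite (qg_mulE y z) (qg_mulE x y) (qg_mulE x) (qg_mulE _ z) mulgA.
Qed.

Lemma qg_mul1 : left_id qg_one qg_mul.
Proof. by elim/quotW=> x; rewrite (qg_mulE 1 x) mul1g. Qed.

Lemma qg_mulr1 : right_id qg_one qg_mul.
Proof. by elim/quotW=> x; rewrite (qg_mulE x 1) mulg1. Qed.

Lemma qg_mulV : left_inverse qg_one qg_inv qg_mul.
Proof. by elim/quotW=> x; rewrite (qg_invE x) (qg_mulE _ x) mulVg. Qed.

Lemma qg_mulrV : right_inverse qg_one qg_inv qg_mul.
Proof. by elim/quotW=> x; rewrite (qg_invE x) (qg_mulE x) mulgV. Qed.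

HB.instance Definition _ := isGroup.Build quotient_group
  qg_mulA qg_mul1 qg_mulr1 qg_mulV qg_mulrV.

End QuotientGroup.

Definition graph_commutators (Gamma : simple_graph) (G : Gamma -> groupType) :
    set (free_product G) :=
  [set x | exists (v w : Gamma) (g : G v) (h : G w),
     adj v w /\ x = [~ fp_incl g, fp_incl h]].

Arguments graph_commutators {Gamma} G.

Definition graph_product (Gamma : simple_graph) (G : Gamma -> groupType) :
    groupType :=
  quotient_group (normal_closure (graph_commutators G)).

(* The product of [{perm A}] applies its left factor first: [permM]. *)

Definition eps_similar (R : realType) (A : finType) (eps : R)
    (f1 f2 : {perm A}) : Prop :=
  (#|[set a | f1 a != f2 a]%SET|%:R <= eps * #|A|%:R)%R.

Record special_quasi_action (R : realType) (G : groupType) (F : set G)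
    (eps : R) (A : finType) (phi : G -> {perm A}) : Prop :=
  SpecialQuasiAction {
    sqa1 : phi 1 = 1 ;
    sqaV : forall g, (phi g)^-1 = phi g^-1 ;
    sqa_free : forall g, F g -> g <> 1 -> forall a, phi g a <> a ;
    sqaM : forall g1 g2, F g1 -> F g2 ->
      eps_similar eps (phi (g1 * g2)) (phi g1 * phi g2) }.

Definition sofic (R : realType) (G : groupType) : Prop :=
  forall eps : R, (0 < eps < 1)%R ->
  forall F : set G, finite_set F ->
  exists A : finType, (0 < #|A|)%N /\
    exists phi : G -> {perm A}, special_quasi_action F eps phi.

(* Main.v *)
Require Import Defs.
From HB Require Import structures.
From mathcomp Require Import all_boot monoid reals.
From mathcomp Require Import all_order all_algebra perm.
From mathcomp Require Import all_classical.

(* A letter g of a normal form acts on a point (p, c), where c assigns to every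
   relevant vertex v a point c v of a set carrying a quasi-action of G_v, by
   moving c v to c v * g and by multiplying p with x_v ^ (e), where e is the
   difference of the colors (injectively chosen in a finite abelian group) of
   the new and the old c v, and the permutations x_v ^ (e) commute for adjacent
   vertices.  The map through which g acts depends on g only through its
   permutation of the v-coordinate, so it inherits the approximate
   multiplicativity of the quasi-action of G_v, while the p-component records a
   reduced word with nonzero exponents in the x_v.  The x_v are chosen so that
   short words of this kind are nontrivial; this is residual finiteness of the
   right-angled Artin group of Gamma, obtained by letting x_v act on tuples
   indexed by words.  Rewriting the product of two normal forms into a normal
   form merges boundedly many pairs of letters, and each merge costs one
   approximation error. *)

Set Implicit Arguments.
Unset Strict Implicit.
Unset Printing Implicit Defensive.

Import Order.TTheory GRing.Theory Num.Theory.

Local Open Scope group_scope.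

HB.instance Definition _ (Gamma : simple_graph) := gen_eqMixin (vertex Gamma).
HB.instance Definition _ (Gamma : simple_graph) :=
  gen_choiceMixin (vertex Gamma).

(** * Shuffles, insertion of letters and reduced words *)

Section ReducedWords.
Variables (Gamma : simple_graph) (G : Gamma -> groupType).
Notation letterT := {v : Gamma & G v}.
Notation word := (seq letterT).
Implicit Types (v w : Gamma) (x y : letterT) (s t u : word).

Definition adjb v w : bool := `[< adj v w >].

Lemma adjbC v w : adjb v w = adjb w v.
Proof. by apply/asboolP/asboolP => /adj_sym. Qed.

Lemma adjbb v : adjb v v = false.
Proof. by apply/asboolP/adj_irrefl. Qed.

Lemma adjb_neq v w : adjb v w -> w == v = false.
Proof. by move=> vw; apply: contraTF vw => /eqP ->; rewrite adjbb. Qed.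

(** Swaps occur only at the front and contexts are built by [shuffle_cons], which suits functions
    defined by recursion on the word; symmetry follows from that of adjacency. *)
Inductive shuffle : word -> word -> Prop :=
| shuffle_refl s : shuffle s s
| shuffle_trans s t u : shuffle s t -> shuffle t u -> shuffle s u
| shuffle_cons x s t : shuffle s t -> shuffle (x :: s) (x :: t)
| shuffle_swap x y s : adjb (tag x) (tag y) ->
    shuffle (x :: y :: s) (y :: x :: s).

Hint Resolve shuffle_refl : core.

Lemma shuffle_sym s t : shuffle s t -> shuffle t s.
Proof.
elim=> {s t} [//|s t u _ ts _ ut|x s t _ ts|x y s xy].
- exact: shuffle_trans ut ts.
- exact: shuffle_cons.
- by apply: shuffle_swap; rewrite adjbC.
Qed.

Lemma shuffle_size s t : shuffle s t -> size s = size t.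
Proof. by elim=> {s t} //= [s t u _ -> _ ->|x s t _ ->]. Qed.

Lemma shuffle_prod (H : groupType) (f : letterT -> H) s t :
  (forall x y, adjb (tag x) (tag y) -> f x * f y = f y * f x) ->
  shuffle s t -> \prod_(x <- s) f x = \prod_(x <- t) f x.
Proof.
move=> fC; elim=> {s t} [//|s t u _ -> _ ->|x s t _ IHs|x y s xy] //.
  by rewrite !big_cons IHs.
by rewrite !big_cons !mulgA fC.
Qed.

Definition push v (g : G v) s : word := if g == 1 then s else letter g :: s.

(** Left multiplication by [g] on reduced words up to shuffle. A letter that finds no partner is
    left where it is blocked instead of returning to the front; up to shuffle this makes no
    difference. *)
Fixpoint insert v (g : G v) s : word :=
  if s is y :: s' then
    if tag y == v then push (g * tagged_as (letter g) y) s'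
    else if adjb v (tag y) then y :: insert g s' else push g s
  else push g [::].

Definition insert_letter x s := insert (tagged x) s.

Definition reduce s := foldr insert_letter [::] s.

(* Some letter of [s] at [v] can be shuffled to the front. *)
Fixpoint exposed v s : bool :=
  if s is y :: s' then (tag y == v) || adjb v (tag y) && exposed v s'
  else false.

Fixpoint reduced s : bool :=
  if s is y :: s' then
    [&& tagged y != 1, ~~ exposed (tag y) s' & reduced s']
  else true.

Lemma reduced_letter s x : reduced s -> x \in s -> tagged x != 1.
Proof.
elim: s => //= y s IHs /and3P[y1 _ /IHs IH]; rewrite inE.
by case/orP => [/eqP->|/IH].
Qed.

Lemma letter_case (P : letterT -> Type) :
  (forall v (g : G v), P (letter g)) -> forall x, P x.
Proof. by move=> IH [v g]; apply: IH. Qed.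

Lemma insert_same v (g h : G v) s : insert g (letter h :: s) = push (g * h) s.
Proof. by rewrite /= eqxx (@tagged_asE _ G (letter g) h). Qed.

Lemma insert_adj v (g : G v) w (h : G w) s : adjb v w ->
  insert g (letter h :: s) = letter h :: insert g s.
Proof. by move=> vw; rewrite /= adjb_neq // vw. Qed.

Lemma insert_far v (g : G v) w (h : G w) s : w == v = false ->
  adjb v w = false -> insert g (letter h :: s) = push g (letter h :: s).
Proof. by rewrite /= => -> ->. Qed.

Lemma push1 v s : push (1 : G v) s = s.
Proof. by rewrite /push eqxx. Qed.

Lemma insert_push_adj v (g : G v) w (h : G w) s : adjb v w ->
  insert g (push h s) = push h (insert g s).
Proof.
by move=> vw; rewrite /push; case: ifP => // _; rewrite insert_adj.
Qed.

Lemma push_cons v (g : G v) w (h : G w) s : adjb v w ->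
  shuffle (push g (letter h :: s)) (letter h :: push g s).
Proof. by move=> vw; rewrite /push; case: ifP => // _; apply: shuffle_swap. Qed.

Lemma pushC v (g : G v) w (h : G w) s : adjb v w ->
  shuffle (push g (push h s)) (push h (push g s)).
Proof.
move=> vw; rewrite [push h s]/push; case: (eqVneq h 1) => [->|h1].
  by rewrite push1.
by rewrite [push h _]/push (negbTE h1); apply: push_cons.
Qed.

Lemma shuffle_push v (g : G v) s t :
  shuffle s t -> shuffle (push g s) (push g t).
Proof. by rewrite /push; case: ifP => // _; apply: shuffle_cons. Qed.

(** The delicate case is a [g] that commutes with only one of the two letters: it stops between them
    in one order and in front of both in the other, and the results differ by swaps. *)
Lemma shuffle_insert_swap v (g : G v) x y s : adjb (tag x) (tag y) ->
  shuffle (insert g (x :: y :: s)) (insert g (y :: x :: s)).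
Proof.
elim/letter_case: x => a g1; elim/letter_case: y => b g2.
move=> ab; change (is_true (adjb a b)) in ab.
have [av|/negbTE av] := eqVneq a v.
  rewrite av in g1 ab *; rewrite insert_same (insert_adj _ _ _ ab).
  by rewrite insert_same; apply: push_cons.
have [bv|/negbTE bv] := eqVneq b v.
  rewrite bv in g2 ab *; rewrite adjbC in ab.
  rewrite insert_same (insert_adj _ _ _ ab) insert_same.
  exact/shuffle_sym/push_cons.
have swap t := @shuffle_swap (letter g1) (letter g2) t ab.
have [va|va] := boolP (adjb v a); have [vb|vb] := boolP (adjb v b).
- by rewrite !insert_adj.
- rewrite insert_adj // ![insert g (letter g2 :: _)]insert_far ?(negbTE vb) //.
  apply: shuffle_trans (shuffle_push g (swap s)).
  exact/shuffle_sym/push_cons.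
- rewrite [X in shuffle _ X]insert_adj //.
  rewrite ![insert g (letter g1 :: _)]insert_far ?(negbTE va) //.
  apply: shuffle_trans (shuffle_push g (swap s)) _.
  exact: push_cons.
- by rewrite !insert_far ?(negbTE va) ?(negbTE vb) //; apply: shuffle_push.
Qed.

Lemma shuffle_insert v (g : G v) s t :
  shuffle s t -> shuffle (insert g s) (insert g t).
Proof.
elim=> {s t} [//|s t u _ st _ tu|x s t st IHs|x y s xy].
- exact: shuffle_trans st tu.
- elim/letter_case: x => w h.
  have [wv|/negbTE wv] := eqVneq w v.
    rewrite wv in h *; rewrite !insert_same.
    exact: shuffle_push.
  have [vw|/negbTE vw] := boolP (adjb v w).
    by rewrite !insert_adj //; apply: shuffle_cons.
  by rewrite !insert_far //; apply/shuffle_push/shuffle_cons.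
- exact: shuffle_insert_swap.
Qed.

Lemma insert1 v s : reduced s -> insert (1 : G v) s = s.
Proof.
elim: s => [|x s IHs]; first by rewrite /= push1.
elim/letter_case: x => w h /= /and3P[h1 _ /IHs IH].
have [wv|/negbTE wv] := eqVneq w v; last by rewrite IH push1; case: ifP.
rewrite wv in h h1 *; rewrite (@tagged_asE _ G (letter (1 : G v)) h) mul1g.
by rewrite /push (negbTE h1).
Qed.

(** Nothing can merge with [g], and all letters it has passed commute with it, so it can be shuffled
    back to the front. *)
Lemma insert_unexposed v (g : G v) s :
  ~~ exposed v s -> shuffle (insert g s) (push g s).
Proof.
elim: s => [//|x s IHs]; elim/letter_case: x => w h /= /norP[/negbTE -> ].
case: ifP => //= vw /IHs IH.
apply: shuffle_trans (shuffle_cons _ IH) _.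
exact/shuffle_sym/push_cons.
Qed.

(** With [insert1] and [insertC], this checks the defining relations of the graph product for
    insertion into reduced words up to shuffle. *)
Lemma insertM v (g h : G v) s :
  reduced s -> shuffle (insert g (insert h s)) (insert (g * h) s).
Proof.
elim: s => [_|x s IHs].
  rewrite [insert h _]/= /push; case: (eqVneq h 1) => [->|h1].
    by rewrite mulg1.
  by rewrite insert_same.
elim/letter_case: x => w k /= /and3P[k1 ks /IHs IH].
have [wv|/negbTE wv] := eqVneq w v.
  rewrite wv in k k1 ks *.
  rewrite (@tagged_asE _ G (letter h) k) (@tagged_asE _ G (letter (g * h)) k).
  (* If [h * k = 1], the letter vanishes and [g] meets [s]; since the word was reduced, [s] exposes
     no letter at [v], so [g] merges with nothing. *)
  rewrite [push (h * k) s]/push; case: (eqVneq (h * k) 1) => [hk|hk].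
    by rewrite -mulgA hk mulg1; apply: insert_unexposed.
  by rewrite insert_same mulgA.
case: ifP => [vw|/negbT vw].
  by rewrite insert_adj //; apply: shuffle_cons.
rewrite [push h _]/push; case: (eqVneq h 1) => [->|h1].
  by rewrite mulg1 insert_far ?(negbTE vw).
by rewrite insert_same.
Qed.

Lemma insertC v (g : G v) w (h : G w) s : adjb v w ->
  shuffle (insert g (insert h s)) (insert h (insert g s)).
Proof.
move=> vw; have wv : adjb w v by rewrite adjbC.
elim: s => [|x s IHs].
  by rewrite !insert_push_adj //; apply: pushC.
elim/letter_case: x => a k.
have [av|/negbTE av] := eqVneq a v.
  rewrite av in k *; rewrite insert_same insert_push_adj //.
  by rewrite (@insert_adj w) // insert_same.
have [aw|/negbTE aw] := eqVneq a w.
  rewrite aw in k *; rewrite insert_same insert_push_adj //.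
  by rewrite (@insert_adj v) // insert_same.
have [va|va] := boolP (adjb v a); have [wa|wa] := boolP (adjb w a).
- by rewrite !insert_adj //; apply: shuffle_cons.
- rewrite (@insert_far w) ?(negbTE wa) // insert_push_adj // (@insert_adj v) //.
  by rewrite (@insert_far w) ?(negbTE wa).
- rewrite (@insert_adj w) // (@insert_far v) ?(negbTE va) //.
  by rewrite (@insert_far v) ?(negbTE va) // insert_push_adj // (@insert_adj w).
- rewrite (@insert_far v _ a) ?(negbTE va) // (@insert_far w _ a) ?(negbTE wa) //.
  rewrite !insert_push_adj // insert_far ?(negbTE va) // insert_far ?(negbTE wa) //.
  exact: pushC.
Qed.

Lemma exposed_push v w (g : G w) s : adjb v w ->
  exposed v (push g s) = exposed v s.
Proof. by rewrite /push => vw; case: ifP => //= _; rewrite vw adjb_neq. Qed.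

Lemma exposed_insert v w (g : G w) s : adjb v w ->
  exposed v (insert g s) = exposed v s.
Proof.
move=> vw; elim: s => [|x s IHs]; first exact: exposed_push.
elim/letter_case: x => a k.
have [aw|/negbTE aw] := eqVneq a w.
  rewrite aw in k *; rewrite insert_same exposed_push //=.
  by rewrite vw adjb_neq.
have [wa|/negbTE wa] := boolP (adjb w a).
  by rewrite insert_adj //= IHs.
by rewrite insert_far // exposed_push.
Qed.

Lemma reduced_push v (g : G v) s :
  ~~ exposed v s -> reduced s -> reduced (push g s).
Proof. by rewrite /push => vs rs; case: ifP => //= /negbT ->; rewrite vs. Qed.

Lemma reduced_insert v (g : G v) s : reduced s -> reduced (insert g s).
Proof.
elim: s => [_|x s IHs]; first exact: reduced_push.
elim/letter_case: x => a k /= /and3P[k1 ks rs].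
have [av|/negbTE av] := eqVneq a v.
  by rewrite av in k k1 ks *; apply: reduced_push.
case: ifP => [va|va] /=.
  by rewrite k1 exposed_insert 1?adjbC // ks IHs.
by apply: reduced_push; rewrite /= ?av ?va ?k1 ?ks.
Qed.

Lemma reduced_foldr s t : reduced t -> reduced (foldr insert_letter t s).
Proof. by elim: s => //= x s IHs /IHs; apply: reduced_insert. Qed.

Lemma shuffle_foldr u s t : shuffle s t ->
  shuffle (foldr insert_letter s u) (foldr insert_letter t u).
Proof. by elim: u => //= x u IHu /IHu; apply: shuffle_insert. Qed.

Lemma reduce_id s : reduced s -> shuffle (reduce s) s.
Proof.
elim: s => [//|x s IHs]; elim/letter_case: x => v g /= /and3P[g1 vs /IHs IH].
apply: shuffle_trans (shuffle_insert g IH) _.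
apply: shuffle_trans (insert_unexposed g vs) _.
by rewrite /push (negbTE g1).
Qed.

Lemma size_push v (g : G v) s : (size (push g s) <= (size s).+1)%N.
Proof. by rewrite /push; case: ifP. Qed.

Lemma size_insert v (g : G v) s : (size (insert g s) <= (size s).+1)%N.
Proof.
elim: s => [|x s IHs] /=; first exact: size_push.
case: ifP => _; first exact: leq_trans (size_push _ _) _.
by case: ifP => _ //; apply: size_push.
Qed.

Lemma size_reduce s : (size (reduce s) <= size s)%N.
Proof. by elim: s => //= x s IHs; apply: leq_trans (size_insert _ _) _. Qed.

(** The length grows only if [g] is neither merged nor trivial, and then [g] has merely passed
    commuting letters. *)
Lemma insert_size_eq v (g : G v) s :
  size (insert g s) = (size s).+1 -> shuffle (insert g s) (letter g :: s).
Proof.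
have push_eq t : size (push g t) = (size t).+1 -> push g t = letter g :: t.
  by rewrite /push; case: ifP => // _ /n_Sn.
elim: s => [|x s IHs]; first by move=> /push_eq /= ->.
elim/letter_case: x => w h.
have [wv|/negbTE wv] := eqVneq w v.
  rewrite wv in h *; rewrite insert_same => /= E.
  by have := size_push (g * h) s; rewrite E ltnn.
have [vw|/negbTE vw] := boolP (adjb v w).
  rewrite insert_adj // => -[/IHs IH]; apply: shuffle_trans (shuffle_cons _ IH) _.
  by apply: shuffle_swap; rewrite adjbC.
by rewrite insert_far // => /push_eq ->.
Qed.

Lemma reduce_size_eq s : size (reduce s) = size s -> shuffle (reduce s) s.
Proof.
elim: s => [//|x s IHs]; elim/letter_case: x => v g /= E.
have s_eq : size (reduce s) = size s.
  apply/eqP; rewrite eqn_leq size_reduce -ltnS -E.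
  exact: size_insert.
apply: shuffle_trans (shuffle_cons _ (IHs s_eq)).
by apply: insert_size_eq; rewrite -/(reduce s) s_eq.
Qed.

(** The action of words by insertion factors through the free product: the two generating relations
    are [insert1] and [insertM], and all intermediate words stay reduced. *)
Lemma word_eq_reduce s s' t : word_eq s s' -> reduced t ->
  shuffle (foldr insert_letter t s) (foldr insert_letter t s').
Proof.
move=> ss' rt; elim: ss' => {s s'} [//|s s' _|s s' u _ ss' _|s u v|s u v g h].
- exact: shuffle_sym.
- exact: shuffle_trans.
- by rewrite !foldr_cat /= /insert_letter /= insert1 // reduced_foldr.
- rewrite !foldr_cat; apply: shuffle_foldr; apply: insertM.
  exact: reduced_foldr.
Qed.

End ReducedWords.

(** * Normal forms in the graph product *)

Section NormalForm.
Variables (Gamma : simple_graph) (G : Gamma -> groupType).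
Notation letterT := {v : Gamma & G v}.
Notation word := (seq letterT).
Implicit Types (v w : Gamma) (x y : letterT) (s t u : word).

Hint Resolve shuffle_refl : core.

Local Notation act := (foldr (@insert_letter Gamma G)).
Local Notation N := (normal_closure (graph_commutators G)).

Definition fp_val s : free_product G :=
  (\pi_(free_product G) (s : Defs.word G))%qT.

Lemma fp_val_cat s t : fp_val (s ++ t) = fp_val s * fp_val t.
Proof. exact/esym/fp_mulE. Qed.

Lemma fp_val_inv s : fp_val (word_inv s) = (fp_val s)^-1.
Proof. exact/esym/fp_invE. Qed.

Lemma fp_valK (z : free_product G) : fp_val (repr z) = z.
Proof. exact: reprK. Qed.

Definition word_val s : graph_product G :=
  (\pi_(quotient_group N) (fp_val s))%qT.

Lemma word_val_cat s t : word_val (s ++ t) = word_val s * word_val t.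
Proof. by rewrite /word_val fp_val_cat [RHS]qg_mulE. Qed.

Lemma word_val_cons x s : word_val (x :: s) = word_val [:: x] * word_val s.
Proof. exact: word_val_cat [:: x] s. Qed.

Lemma word_val_adj x y : adjb (tag x) (tag y) ->
  word_val [:: x] * word_val [:: y] = word_val [:: y] * word_val [:: x].
Proof.
elim/letter_case: x => v g; elim/letter_case: y => w h /asboolP vw.
rewrite [LHS]qg_mulE [RHS]qg_mulE; apply/esym/eqP/quotient_groupP => M SM.
apply: SM; exists v, w, g, h; split => //.
by rewrite /commg /conjg invgM -mulgA.
Qed.

Lemma word_val_word_eq s t : word_eq s t -> word_val s = word_val t.
Proof. by move=> st; congr (\pi_(quotient_group N) _)%qT; apply/eqP/free_productP. Qed.

Lemma word_val_push v (g : G v) s :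
  word_val (push g s) = word_val [:: letter g] * word_val s.
Proof.
rewrite /push -word_val_cat; case: eqP => [->|//].
exact/esym/word_val_word_eq/(word_eq1 [::]).
Qed.

Lemma word_val_insert v (g : G v) s :
  word_val (insert g s) = word_val [:: letter g] * word_val s.
Proof.
elim: s => [|x s IHs]; first exact: word_val_push.
elim/letter_case: x => w h.
have [wv|/negbTE wv] := eqVneq w v.
  rewrite wv in h *; rewrite insert_same word_val_push -!word_val_cat.
  exact/esym/word_val_word_eq/(word_eqM [::]).
have [vw|/negbTE vw] := boolP (adjb v w).
  rewrite insert_adj // (word_val_cons _ (insert g s)) (word_val_cons _ s) IHs.
  by rewrite !mulgA word_val_adj // adjbC.
by rewrite insert_far // word_val_push.
Qed.

Lemma word_val_reduce s : word_val (reduce s) = word_val s.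
Proof.
elim: s => [//|x s IHs]; elim/letter_case: x => v g.
by rewrite [LHS]word_val_insert IHs -word_val_cat.
Qed.

Lemma word_val_inv s : word_val (word_inv s) = (word_val s)^-1.
Proof.
apply: (mulIg (word_val s)); rewrite mulVg -word_val_cat.
exact/word_val_word_eq/word_eqV.
Qed.

(** The elements that act trivially on reduced words up to shuffle form a normal subgroup [K]; it
    contains the commutators of adjacent vertex groups, hence their normal closure. *)
Lemma act_nclosure (z : free_product G) t :
  nsub_set N z -> reduced t -> shuffle (act t (repr z)) t.
Proof.
pose K : set (free_product G) :=
  [set z | forall t, reduced t -> shuffle (act t (repr z)) t]%classic.
(* Membership in [K] may be tested on any word for the element, not just on the chosen one. *)
have KE (s : word) (z' : free_product G) : z' = fp_val s ->
    K z' <-> forall t, reduced t -> shuffle (act t s) t.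
  move=> -> ; split=> Ks u ru; have := word_eq_reduce (pi_repr s) ru.
    by move/shuffle_sym => h; apply: shuffle_trans h (Ks _ ru).
  by move=> h; apply: shuffle_trans h (Ks _ ru).
have K1 : K 1 by apply/(KE [::]).
have KM z1 z2 : K z1 -> K z2 -> K (z1 * z2).
  move=> K1' K2'; apply/(KE _ _ (erefl (z1 * z2))) => u ru; rewrite foldr_cat.
  apply: shuffle_trans (shuffle_foldr _ (K2' _ ru)) _.
  exact: K1'.
have KV z1 : K z1 -> K z1^-1.
  move=> K1'; apply/(KE _ _ (erefl z1^-1)) => u ru.
  apply: shuffle_trans (shuffle_foldr _ (shuffle_sym (K1' u ru))) _.
  rewrite -foldr_cat; apply: (word_eq_reduce (t := u) (word_eqV _)) => //.
have actKV v (g : G v) u : reduced u -> shuffle (insert g^-1 (insert g u)) u.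
  move=> ru; apply: shuffle_trans (insertM _ _ ru) _.
  by rewrite mulVg insert1.
have KJ z1 z2 : K z1 -> K (z1 ^ z2).
  move=> K1'; apply/(KE (word_inv (repr z2) ++ repr z1 ++ repr z2)).
    by rewrite !fp_val_cat fp_val_inv !fp_valK.
  move=> u ru; rewrite !foldr_cat.
  apply: shuffle_trans (shuffle_foldr _ (K1' _ (reduced_foldr _ ru))) _.
  by rewrite -foldr_cat; apply: (word_eq_reduce (t := u) (word_eqV _)).
move=> Nz; apply: (Nz (NormalSubgroup K1 KM KV KJ)).
move=> _ [v [w [g [h [/asboolP vw ->]]]]].
apply/(KE [:: letter g^-1; letter h^-1; letter g; letter h]).
  rewrite -[fp_incl g]/(fp_val [:: letter g]) -[fp_incl h]/(fp_val [:: letter h]).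
  rewrite -[RHS]/(fp_val (word_inv [:: letter g] ++ word_inv [:: letter h]
    ++ [:: letter g] ++ [:: letter h])).
  by rewrite !fp_val_cat !fp_val_inv.
move=> u ru; rewrite /= /insert_letter /=.
have ghC : shuffle (insert h^-1 (insert g (insert h u))) (insert g u).
  apply: shuffle_trans (insertC _ _ _ _) _; first by rewrite adjbC.
  exact/shuffle_insert/actKV.
apply: shuffle_trans (shuffle_insert _ ghC) _; exact: actKV.
Qed.

(** The quotient of the two values is trivial, so the inverse of [s] carries [reduce t] to the empty
    word; acting by [s] on both sides turns this into the claim. *)
Lemma reduce_word_val s t :
  word_val s = word_val t -> shuffle (reduce s) (reduce t).
Proof.
move=> /eqP/quotient_groupP /act_nclosure /(_ (isT : reduced [::])).
move=> h; have {h} : shuffle (act (reduce t) (word_inv s)) [::].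
  rewrite -foldr_cat; apply: shuffle_trans h.
  apply/shuffle_sym/(word_eq_reduce (t := [::])) => //.
  by apply/free_productP/eqP; rewrite -!/(fp_val _) fp_val_cat fp_val_inv fp_valK.
move=> /(shuffle_foldr s) h; apply/shuffle_sym; apply: shuffle_trans h.
rewrite -foldr_cat; apply/shuffle_sym.
apply: (word_eq_reduce (t := reduce t) (s' := [::])); last exact: reduced_foldr.
by rewrite -{1}[s]word_invK; apply: word_eqV.
Qed.

(** No canonical order of letters is chosen, so laws for products and inverses hold up to shuffle,
    and only shuffle-invariant functions are applied to it later. *)
Definition normal_form (z : graph_product G) : word :=
  reduce (repr (repr z : free_product G)).

Lemma normal_formK z : word_val (normal_form z) = z.
Proof. by rewrite word_val_reduce /word_val fp_valK reprK. Qed.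

Lemma reduced_normal_form z : reduced (normal_form z).
Proof. exact: reduced_foldr. Qed.

Lemma normal_form_reduce s : shuffle (normal_form (word_val s)) (reduce s).
Proof. by apply: reduce_word_val; rewrite /word_val fp_valK reprK. Qed.

Lemma normal_form1 : normal_form 1 = [::].
Proof.
by have := shuffle_size (normal_form_reduce [::]); case: normal_form.
Qed.

(** Inserting the letters of the first factor one by one bounds the number of merges by the length
    of its normal form. *)
Lemma normal_formM z1 z2 :
  shuffle (normal_form (z1 * z2)) (act (normal_form z2) (normal_form z1)).
Proof.
rewrite -{1}(normal_formK z1) -{1}(normal_formK z2) -word_val_cat.
apply: shuffle_trans (normal_form_reduce _) _; rewrite /reduce foldr_cat.
exact/shuffle_foldr/reduce_id/reduced_normal_form.
Qed.

(* Neither [z] nor [z^-1] can have the longer normal form, so reducing the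
   inverse of a normal form loses no letter. *)
Lemma normal_formV z : shuffle (normal_form z^-1) (word_inv (normal_form z)).
Proof.
have size_inv (s : word) : size (word_inv s) = size s by rewrite size_rev size_map.
have le_size z' : (size (normal_form z'^-1) <= size (normal_form z'))%N /\
    shuffle (normal_form z'^-1) (reduce (word_inv (normal_form z'))).
  have sh : shuffle (normal_form z'^-1) (reduce (word_inv (normal_form z'))).
    by rewrite -{1}(normal_formK z') -word_val_inv; apply: normal_form_reduce.
  by split=> //; rewrite (shuffle_size sh) -(size_inv (normal_form _)) size_reduce.
have [le1 sh] := le_size z; have [le2 _] := le_size z^-1.
rewrite invgK in le2; apply: shuffle_trans (sh) _; apply: reduce_size_eq.
by apply/eqP; rewrite size_inv -(shuffle_size sh) eqn_leq le1.
Qed.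

End NormalForm.

(** * Finite permutation actions detecting short reduced words *)

Section TraceAction.
Variables (I : finType) (com : rel I) (Z : finZmodType) (n : nat).
Hypothesis com_refl : reflexive com.
Implicit Types (i j w : I) (p q r u : seq I) (e : Z).

(* Words over [I] in which no two occurrences of a letter can be brought
   together by commutations. *)
Fixpoint reachable i u : bool :=
  if u is w :: u' then (w == i) || com i w && reachable i u' else false.

Fixpoint trace_reduced u : bool :=
  if u is w :: u' then ~~ reachable w u' && trace_reduced u' else true.

(* A coordinate is a reversed prefix of a word. *)
Definition state := {ffun n.-bseq I -> Z}.
Implicit Types x : state.

(** The default 0 for words longer than [n] lets gates and prefixes be handled without length
    bounds. *)
Definition coord x u : Z := if insub u is Some b then x b else 0%R.

(* The last letter of the prefix that does not commute with [i] has been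
   visited with a nonzero total exponent. *)
Fixpoint gate i q (f : seq I -> Z) : bool :=
  if q is w :: r then if com i w then gate i r f else f q != 0%R else true.

Definition gain i e (f : seq I -> Z) u : Z :=
  if u is j :: q then if (j == i) && gate i q f then e else 0%R else 0%R.

Definition shift i e x : state :=
  [ffun b : n.-bseq I => x b + gain i e (coord x) b]%R.

Lemma coord_shift i e x u : (size u <= n)%N ->
  coord (shift i e x) u = (coord x u + gain i e (coord x) u)%R.
Proof. by move=> un; rewrite /coord insubT ffunE. Qed.

Lemma coord_shift_neq i e x w r : w != i ->
  coord (shift i e x) (w :: r) = coord x (w :: r).
Proof.
move=> /negbTE wi; have [le_n|gt_n] := leqP (size (w :: r)) n.
  by rewrite coord_shift //= wi addr0.
by rewrite /coord insubF //= leqNgt gt_n.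
Qed.

(** The gate of [i] reads at most one coordinate, headed by a letter not commuting with [i], while
    the shift by [j] changes only coordinates headed by [j]. The case [i = j] gives additivity of
    shifts, the other cases their commutation. *)
Lemma gate_shift i j e x q : com i j ->
  gate i q (coord (shift j e x)) = gate i q (coord x).
Proof.
move=> ij; elim: q => //= w r ->; case: ifP => // iw.
by rewrite coord_shift_neq //; apply: contraFneq iw => ->.
Qed.

Lemma gain_shift i j e e' x u : com i j ->
  gain i e (coord (shift j e' x)) u = gain i e (coord x) u.
Proof. by case: u => //= w r ij; rewrite gate_shift. Qed.

Lemma shiftD i e e' x : shift i e' (shift i e x) = shift i (e + e')%R x.
Proof.
apply/ffunP => b; rewrite !ffunE gain_shift // -addrA; congr (_ + _)%R.
by rewrite /gain; case: (b : seq I) => [|j q]; rewrite ?addr0 //;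
  case: ifP; rewrite ?addr0.
Qed.

Lemma shift0 i x : shift i 0%R x = x.
Proof.
apply/ffunP => b; rewrite !ffunE /gain.
by case: (b : seq I) => [|j q]; rewrite ?addr0 //; case: ifP; rewrite ?addr0.
Qed.

Lemma shiftC i j e e' x : com i j -> com j i ->
  shift i e (shift j e' x) = shift j e' (shift i e x).
Proof.
move=> ij ji; apply/ffunP => b; rewrite !ffunE !gain_shift //.
by rewrite -!addrA [X in (_ + X)%R]addrC.
Qed.

Lemma shift_inj i e : injective (shift i e).
Proof.
by apply: (can_inj (g := shift i (- e)%R)) => x; rewrite shiftD subrr shift0.
Qed.

Definition shift_perm i e : {perm state} := perm (@shift_inj i e).

Lemma shift_permD i e e' :
  shift_perm i (e + e')%R = shift_perm i e * shift_perm i e'.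
Proof. by apply/perm.permP => x; rewrite permM !permE shiftD. Qed.

Lemma shift_permC i j e e' : com i j -> com j i ->
  shift_perm i e * shift_perm j e' = shift_perm j e' * shift_perm i e.
Proof. by move=> ij ji; apply/perm.permP => x; rewrite !permM !permE shiftC. Qed.

(** Everything above the letter read by the gate commutes with [i], so that letter does not recur
    above it, and the hypothesis applies to it. *)
Lemma gate_open i q (f : seq I -> Z) :
  (forall p w r, q = p ++ w :: r -> w \notin p -> f (w :: r) != 0%R) ->
  gate i q f.
Proof.
move=> fq; suff : forall p w r, q = p ++ w :: r -> all (com i) p -> ~~ com i w ->
    f (w :: r) != 0%R.
  elim: (q) => //= w r IHq fqr; case: ifP => [iw|/negbT iw].
    by apply: IHq => p w' r' rE pi; apply: (fqr (w :: p)); rewrite /= ?rE ?iw.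
  exact: (fqr [::]).
move=> p w r qE /allP pi iw; apply: fq qE _.
by apply: contraNN iw => /pi.
Qed.

Lemma gate_closed i p q (f : seq I -> Z) :
  (forall p1 w p2, p = p1 ++ w :: p2 -> f (w :: p2 ++ q) = 0%R) ->
  has (predC (com i)) p -> gate i (p ++ q) f = false.
Proof.
elim: p => //= w p IHp fp; case: ifP => [iw /=|iw _]; last first.
  by rewrite (fp [::] w p) ?eqxx.
by apply: IHp => p1 w' p2 pE; apply: (fp (w :: p1)); rewrite pE.
Qed.

Lemma reachable_blocked i p u :
  ~~ reachable i (p ++ i :: u) -> has (predC (com i)) p.
Proof.
elim: p => [|w p IHp] /=; first by rewrite eqxx.
by case/norP=> _; case: (com i w) => //= /IHp.
Qed.

(* While a reduced word is being read, the last-visited coordinate of every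
   letter stays nonzero and the coordinates not yet reached stay zero. *)
Lemma shift_word_coord (s : seq (I * Z)) q x :
  (size s + size q <= n)%N -> trace_reduced (map fst s) ->
  all (fun z => z.2 != 0%R) s ->
  (forall p w r, q = p ++ w :: r -> w \notin p -> coord x (w :: r) != 0%R) ->
  (forall p t, map fst s = p ++ t -> p != [::] -> coord x (rev p ++ q) = 0%R) ->
  forall p w r, rev (map fst s) ++ q = p ++ w :: r -> w \notin p ->
    coord ((\prod_(z <- s) shift_perm z.1 z.2) x) (w :: r) != 0%R.
Proof.
elim: s q x => [|[i e] s IHs] q x /=.
  by move=> _ _ _ xq _ p w r; rewrite big_nil perm1; apply: xq.
move=> le_n /andP[ri rs] /andP[e0 s0] xq xs p w r.
rewrite rev_cons cat_rcons => qE wp.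
rewrite big_cons permM permE; apply: IHs (qE) (wp) => //=.
- by rewrite addnS.
- move=> {w r p qE wp} p w r; have [->|wi] := eqVneq w i.
    (* As [i] is not in [p], the prefix [p] is empty: the coordinate is [i :: q], which was 0 and
       receives [e] through an open gate. *)
    case: p => [|j p] /= [ <- ]; last by rewrite inE eqxx.
    move=> _.
    have le_q : (size (i :: q) <= n)%N.
      by apply: leq_trans le_n; rewrite /= addSn ltnS leq_addl.
    rewrite coord_shift //= eqxx gate_open // (xs [:: i] (map fst s)) //.
    by rewrite add0r.
  rewrite coord_shift_neq //; case: p => [[wi' _]|j p [_ qE]].
    by rewrite wi' eqxx in wi.
  by rewrite inE negb_or => /andP[_]; apply: xq.
- move=> {w r p qE wp} p t sE p0; case/lastP: p sE p0 => // p w sE _.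
  have xs0 p' t' : map fst s = p' ++ t' -> coord x (rev p' ++ i :: q) = 0%R.
    by move=> sE'; have := xs (i :: p') t'; rewrite sE' rev_cons cat_rcons; apply.
  have xpq := xs0 _ _ sE.
  (* An unreached coordinate could change only if headed by a later [i]. Reducedness puts a letter
     not commuting with [i] in between; the coordinates of such letters are still 0, so the gate is
     closed. *)
  rewrite rev_rcons in xpq *; have [wi|wi] := eqVneq w i; last first.
    by rewrite coord_shift_neq.
  rewrite wi in xpq sE *.
  have [le_p|gt_p] := leqP (size (i :: rev p ++ i :: q)) n; last first.
    by rewrite /coord insubF //= leqNgt gt_p.
  rewrite coord_shift //= [coord x _]xpq eqxx gate_closed ?addr0 //.
    move=> p1 w' p2 pE.
    have := xs0 (rcons (rev p2) w') (rev p1 ++ i :: t).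
    rewrite rev_rcons revK; apply.
    by rewrite sE -[p]revK pE rev_cat rev_cons -!cats1 -!catA.
  rewrite has_rev; apply: (@reachable_blocked _ _ t).
  by rewrite -cat_rcons -sE.
Qed.

(** Started at the zero state, the word makes the coordinate indexed by its own reversal nonzero. *)
Lemma shift_word_neq1 (s : seq (I * Z)) :
  (size s <= n)%N -> trace_reduced (map fst s) ->
  all (fun z => z.2 != 0%R) s -> s != [::] ->
  \prod_(z <- s) shift_perm z.1 z.2 != 1.
Proof.
move=> le_n rs s0; case/lastP: s le_n rs s0 => // s [w e] le_n rs s0 _.
have x0 u : coord [ffun=> 0%R] u = 0%R.
  by rewrite /coord; case: insub => // b; rewrite ffunE.
have := @shift_word_coord (rcons s (w, e)) [::] [ffun=> 0%R] _ rs s0.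
rewrite addn0 => /(_ le_n) /(_ _ (fun _ _ _ _ => x0 _)).
have nil_split p w' r : [::] = p ++ w' :: r -> w' \notin p ->
  coord [ffun=> 0%R] (w' :: r) != 0%R by case: p.
move=> /(_ nil_split [::] w (rev (map fst s))).
rewrite map_rcons rev_rcons cats0 => /(_ erefl isT).
by apply: contraNneq => ->; rewrite perm1 x0.
Qed.

End TraceAction.

(** * Similarity of permutations and quasi-actions through a coordinate *)

Section Similarity.
Variables (R : realType) (A : finType).
Implicit Types (e d : R) (f g h : {perm A}).

Lemma eps_similar_refl e f : (0 <= e)%R -> eps_similar e f f.
Proof.
move=> e0; rewrite /eps_similar (_ : [set _ | _]%SET = finset.set0);
  first by rewrite cards0 mulr_ge0.
by apply/finset.setP => a; rewrite !inE eqxx.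
Qed.

Lemma eps_similar_le e d f g : (e <= d)%R -> eps_similar e f g -> eps_similar d f g.
Proof. by move=> ed /le_trans; apply; rewrite ler_wpM2r. Qed.

Lemma eps_similar_trans e d f g h :
  eps_similar e f g -> eps_similar d g h -> eps_similar (e + d)%R f h.
Proof.
rewrite /eps_similar mulrDl => fg gh; apply: le_trans (lerD fg gh).
rewrite -natrD ler_nat; apply: leq_trans (leq_card_setU _ _); apply/subset_leq_card.
apply/fintype.subsetP => a; rewrite !inE -negb_and.
by apply: contraNN => /andP[/eqP-> /eqP->].
Qed.

Lemma eps_similarMr e f g h : eps_similar e f g -> eps_similar e (f * h) (g * h).
Proof.
rewrite /eps_similar; congr (_ <= _)%R; congr (_%:R)%R; apply: eq_card => a.
by rewrite !inE !permM (inj_eq perm_inj).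
Qed.

Lemma eps_similarMl e f g h : eps_similar e f g -> eps_similar e (h * f) (h * g).
Proof.
rewrite /eps_similar; congr (_ <= _)%R; congr (_%:R)%R.
rewrite -[LHS](card_preimset (f := h)); last exact: perm_inj.
by apply: eq_card => a; rewrite !inE !permM.
Qed.

End Similarity.

(* A set [B] in which a coordinate with values in [A] can be read and
   overwritten; permutations of [A] then act on [B] through that coordinate. *)
Section Lens.
Variables (B A : finType) (get : B -> A) (put : B -> A -> B).
Hypothesis get_put : forall b a, get (put b a) = a.
Hypothesis put_get : forall b, put b (get b) = b.
Hypothesis put_put : forall b a a', put (put b a) a' = put b a'.
Implicit Types f g : {perm A}.

Definition lens_fun f b := put b (f (get b)).

Lemma lens_fun_inj f : injective (lens_fun f).
Proof.
by apply: (can_inj (g := lens_fun f^-1)) => b;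
  rewrite /lens_fun get_put put_put permK put_get.
Qed.

Definition lens_perm f : {perm B} := perm (@lens_fun_inj f).

Lemma lens_permE f b : lens_perm f b = put b (f (get b)).
Proof. by rewrite permE. Qed.

Lemma lens_permM : {morph lens_perm : f g / f * g}.
Proof.
by move=> f g; apply/perm.permP => b; rewrite permM !lens_permE permM get_put put_put.
Qed.

Lemma lens_perm1 : lens_perm 1 = 1.
Proof. by apply/perm.permP => b; rewrite lens_permE !perm1 put_get. Qed.

Lemma lens_permV : {morph lens_perm : f / f^-1}.
Proof.
by move=> f; apply: (mulIg (lens_perm f)); rewrite -lens_permM !mulVg lens_perm1.
Qed.

(** Disagreement at [b] forces disagreement at [get b]. Exchanging the coordinate of [b] with a free
    [a] injects [D * A] into [C * B], which compares the two proportions. *)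
Lemma lens_perm_similar (R : realType) (e : R) f g : (0 < #|A|)%N ->
  eps_similar e f g -> eps_similar e (lens_perm f) (lens_perm g).
Proof.
rewrite /eps_similar => A0 fg; set D := [set b | _]%SET.
set C := [set a | _]%SET in fg.
have A0' : (0 < #|A|%:R :> R)%R by rewrite ltr0n.
rewrite -(ler_pM2r A0'); apply: le_trans (_ : #|C|%:R * #|B|%:R <= _)%R; last first.
  by rewrite mulrAC ler_wpM2r.
rewrite -!natrM ler_nat -cardsT -[X in (_ <= _ * X)%N]cardsT -!cardsX.
pose swap (z : B * A) := (get z.1, put z.1 z.2).
have swap_inj : injective swap.
  apply: (can_inj (g := fun z => (put z.2 z.1, get z.2))) => -[b a].
  by rewrite /swap /= put_put put_get get_put.
rewrite -(card_imset _ swap_inj); apply/subset_leq_card/fintype.subsetP => z.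
case/imsetP => -[b a]; rewrite finset.in_setX finset.in_setT andbT => Db ->.
rewrite finset.in_setX finset.in_setT andbT /=; move: Db; rewrite !inE.
by apply: contraNN; rewrite !lens_permE => /eqP->.
Qed.

Lemma lens_quasi_action (R : realType) (G : groupType) (F : set G) (e : R)
    (phi : G -> {perm A}) : (0 < #|A|)%N -> special_quasi_action F e phi ->
  special_quasi_action F e (fun z => lens_perm (phi z)).
Proof.
move=> A0 [phi1 phiV phi_free phiM]; split.
- by rewrite phi1 lens_perm1.
- by move=> z; rewrite -lens_permV phiV.
- move=> z Fz z1 b /(congr1 get); rewrite lens_permE get_put.
  exact: phi_free.
- by move=> y z Fy Fz; rewrite -lens_permM; apply: lens_perm_similar => //; apply: phiM.
Qed.

End Lens.

(** The product of the individual sets works, each group acting on its own factor. A single set for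
    all relevant vertices allows a single coloring. *)
Lemma common_quasi_action (R : realType) (V : eqType) (G : V -> groupType)
    (e : R) (F : forall v, set (G v)) (vs : seq V) :
  (0 < e < 1)%R -> (forall v, finite_set (F v)) -> (forall v, sofic R (G v)) ->
  exists A : finType, (0 < #|A|)%N /\ forall v, v \in vs ->
    exists phi : G v -> {perm A}, special_quasi_action (F v) e phi.
Proof.
move=> e01 finF soficG; elim: vs => [|v vs [A [A0 IH]]].
  by exists unit; rewrite card_unit.
have [A' [A'0 [phi phiP]]] := soficG v e e01 (F v) (finF v).
exists (A' * A)%type; split=> [|w]; first by rewrite card_prod muln_gt0 A'0.
rewrite inE; have [->|/= _] := eqVneq w v => [_|/IH[psi psiP]].
  pose upd (z : A' * A) (a : A') := (a, z.2).
  have h1 z a : (upd z a).1 = a by [].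
  have h2 z : upd z z.1 = z by case: z.
  have h3 z a a' : upd (upd z a) a' = upd z a' by [].
  by eexists; apply: (lens_quasi_action h1 h2 h3 A'0 phiP).
pose upd (z : A' * A) (a : A) := (z.1, a).
have h1 z a : (upd z a).2 = a by [].
have h2 z : upd z z.2 = z by case: z.
have h3 z a a' : upd (upd z a) a' = upd z a' by [].
by eexists; apply: (lens_quasi_action h1 h2 h3 A0 psiP).
Qed.

(** * Recording color changes by words of shifts *)

Section ColoredAction.
Variables (I : finType) (com : rel I) (A : finType) (n : nat).
Variables (Z : finZmodType) (color : A -> Z).
Hypothesis com_refl : reflexive com.
Implicit Types (i j : I) (a : A) (f g : {perm A}).

Definition gallery := ({perm state I Z n} * {ffun I -> A})%type.
Implicit Types b : gallery.

Definition gallery_get i b := b.2 i.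

Definition gallery_put i b a : gallery :=
  (b.1 * shift_perm n com_refl i (color a - color (b.2 i))%R,
   [ffun j => if j == i then a else b.2 j]).

Lemma gallery_get_put i b a : gallery_get i (gallery_put i b a) = a.
Proof. by rewrite /gallery_get /= ffunE eqxx. Qed.

Lemma gallery_put_get i b : gallery_put i b (gallery_get i b) = b.
Proof.
case: b => p c; rewrite /gallery_put /gallery_get /= subrr.
congr (_, _).
  by rewrite (_ : shift_perm _ _ _ _ = 1) ?mulg1 //;
    apply/perm.permP => x; rewrite permE perm1 shift0.
by apply/ffunP => j; rewrite ffunE; case: eqP => [->|].
Qed.

(** Differences of colors telescope; this is what makes overwriting a coordinate, together with its
    record, compatible with composition in [{perm A}]. *)
Lemma gallery_put_put i b a a' :
  gallery_put i (gallery_put i b a) a' = gallery_put i b a'.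
Proof.
rewrite /gallery_put /= ffunE eqxx; congr (_, _).
  by rewrite -mulgA -shift_permD addrCA addrAC subrr add0r.
by apply/ffunP => j; rewrite !ffunE; case: eqP.
Qed.

Definition vertex_perm i f : {perm gallery} :=
  lens_perm (gallery_get_put i) (gallery_put_get i) (gallery_put_put i) f.

Lemma vertex_permE i f b : vertex_perm i f b = gallery_put i b (f (b.2 i)).
Proof. exact: lens_permE. Qed.

Lemma vertex_permC i j f g : com i j -> com j i -> i != j ->
  vertex_perm i f * vertex_perm j g = vertex_perm j g * vertex_perm i f.
Proof.
move=> ij ji /negbTE i'j; apply/perm.permP => b; rewrite !permM !vertex_permE.
have j'i : (j == i) = false by rewrite eq_sym.
rewrite /gallery_put /= !ffunE i'j j'i -!mulgA shift_permC //.
congr (_, _); apply/ffunP => k; rewrite !ffunE.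
by have [->|//] := eqVneq k i; rewrite i'j.
Qed.

(** The first component of [b] is multiplied by a word of shifts. Its exponents depend on [b], but
    its vertices are those of [s]; the exponents are nonzero because no letter has a fixed point and
    colors are injective. So [shift_word_neq1] applies. *)
Lemma vertex_word_free (s : seq (I * {perm A})) b :
  (size s <= n)%N -> trace_reduced com (map fst s) -> s != [::] ->
  injective color -> (forall z, z \in s -> forall a, z.2 a != a) ->
  (\prod_(z <- s) vertex_perm z.1 z.2) b != b.
Proof.
move=> le_n rs s_neq0 color_inj fs.
have [es [esE es0 bE]] : exists es : seq (I * Z),
    [/\ map fst es = map fst s, all (fun z => z.2 != 0%R) es &
        ((\prod_(z <- s) vertex_perm z.1 z.2) b).1 =
        b.1 * \prod_(z <- es) shift_perm n com_refl z.1 z.2].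
  elim: s b fs {le_n rs s_neq0} => [|[i f] s IHs] b fs.
    by exists [::]; rewrite !big_nil perm1 mulg1.
  have [|es [esE es0 bE]] := IHs (vertex_perm i f b).
    by move=> z zs; apply: fs; rewrite inE zs orbT.
  exists ((i, color (f (b.2 i)) - color (b.2 i))%R :: es); split.
  - by rewrite /= esE.
  - rewrite /= es0 andbT subr_eq0 (inj_eq color_inj).
    by apply: (fs (i, f)); rewrite inE eqxx.
  - by rewrite !big_cons permM bE vertex_permE -mulgA.
have := @shift_word_neq1 _ com _ n com_refl es.
rewrite esE es0 rs -(size_map fst) esE size_map le_n.
have es_neq0 : es != [::].
  by rewrite -size_eq0 -(size_map fst) esE size_map size_eq0.
move=> /(_ isT isT isT es_neq0); apply: contraNneq => /(congr1 fst).
by rewrite bE => /(canRL (mulKg _)); rewrite mulVg => ->.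
Qed.

End ColoredAction.

(** * The action of words over the vertex groups *)

Section GraphProductAction.
Variables (R : realType) (Gamma : simple_graph) (G : Gamma -> groupType).
Variables (vs : seq Gamma) (A : finType) (n : nat).
Variables (Z : finZmodType) (color : A -> Z).
Hypothesis color_inj : injective color.
Variable phi : forall v, G v -> {perm A}.
Hypothesis phi1 : forall v, phi (1 : G v) = 1.
Hypothesis phiV : forall v (g : G v), (phi g)^-1 = phi g^-1.
Hypothesis A_gt0 : (0 < #|A|)%N.
Notation letterT := {v : Gamma & G v}.
Notation word := (seq letterT).
Implicit Types (v w : Gamma) (x y : letterT) (s t : word).

Local Notation act := (foldr (@insert_letter Gamma G)).

(** Equality is added to adjacency because shifts at one vertex commute with each other. *)
Definition commuting : rel (seq_sub vs) :=
  fun i j => (i == j) || adjb (val i) (val j).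

Lemma commuting_refl : reflexive commuting.
Proof. by move=> i; rewrite /commuting eqxx. Qed.

Local Notation point := (gallery (seq_sub vs) A n Z).

(** Letters outside [vs] act trivially, so that inverses and shuffles are respected by all words. *)
Definition letter_perm x : {perm point} :=
  if insub (tag x) is Some i then vertex_perm n color commuting_refl i (phi (tagged x))
  else 1.

Definition word_perm s := \prod_(x <- s) letter_perm x.

Lemma word_perm_cons x s : word_perm (x :: s) = letter_perm x * word_perm s.
Proof. by rewrite /word_perm big_cons. Qed.

Lemma letter_perm1 v : letter_perm (letter (1 : G v)) = 1.
Proof.
by rewrite /letter_perm; case: insub => // i; rewrite /= phi1 [LHS]lens_perm1.
Qed.

Lemma letter_permV v (g : G v) :
  letter_perm (letter g^-1) = (letter_perm (letter g))^-1.
Proof.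
rewrite /letter_perm /=; case: insub => [i|]; last by rewrite invg1.
by rewrite -phiV [LHS]lens_permV.
Qed.

Lemma letter_permC x y : adjb (tag x) (tag y) ->
  letter_perm x * letter_perm y = letter_perm y * letter_perm x.
Proof.
rewrite /letter_perm => xy; case: insubP => [i _ ix|_]; last by rewrite mulg1 mul1g.
case: insubP => [j _ jy|_]; last by rewrite mulg1 mul1g.
have ij : adjb (val i) (val j) by rewrite ix jy.
apply: vertex_permC; rewrite /commuting; first by rewrite ij orbT.
  by rewrite adjbC ij orbT.
by apply: contraTneq ij => ->; rewrite adjbb.
Qed.

Lemma word_perm_shuffle s t : shuffle s t -> word_perm s = word_perm t.
Proof. exact/shuffle_prod/letter_permC. Qed.

Lemma word_permV s : word_perm (word_inv s) = (word_perm s)^-1.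
Proof.
elim: s => [|[v g] s IHs]; first by rewrite /word_perm !big_nil invg1.
rewrite (word_inv_cons g) word_perm_cons invgM -IHs.
by rewrite {1}/word_perm big_cat big_seq1 -letter_permV.
Qed.

Lemma word_perm_push v (g : G v) s :
  word_perm (push g s) = letter_perm (letter g) * word_perm s.
Proof.
rewrite /push; case: eqP => [->|_]; last exact: word_perm_cons.
by rewrite letter_perm1 mul1g.
Qed.

Lemma reachable_exposed (i : seq_sub vs) (u : seq (seq_sub vs)) s :
  map val u = map tag s -> reachable commuting i u = exposed (val i) s.
Proof.
elim: u s => [|j u IHu] [|x s] //= [jx /IHu ->].
rewrite -jx /commuting (inj_eq val_inj) [i == j]eq_sym.
by case: (eqVneq j i).
Qed.

Lemma trace_reduced_reduced (u : seq (seq_sub vs)) s :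
  map val u = map tag s -> reduced s -> trace_reduced commuting u.
Proof.
elim: u s => [|j u IHu] [|x s] //= [jx us] /and3P[_].
by rewrite -jx (reachable_exposed _ us) => -> /(IHu _ us).
Qed.

Lemma word_perm_free s b : (size s <= n)%N -> reduced s -> s != [::] ->
  (forall x, x \in s -> tag x \in vs /\ forall a, phi (tagged x) a != a) ->
  word_perm s b != b.
Proof.
move=> le_n rs s0 fs.
have [s' [s'E sE fs']] : exists s' : seq (seq_sub vs * {perm A}),
    [/\ map val (map fst s') = map tag s,
        word_perm s = \prod_(z <- s') vertex_perm n color commuting_refl z.1 z.2 &
        forall z, z \in s' -> forall a, z.2 a != a].
  elim: s fs {le_n rs s0} => [|x s IHs] fs.
    by exists [::]; rewrite /word_perm !big_nil.
  have [|s' [s'E sE fs']] := IHs.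
    by move=> y ys; apply: fs; rewrite inE ys orbT.
  have [xvs fx] := fs x (mem_head _ _).
  exists ((SeqSub xvs, phi (tagged x)) :: s'); split.
  - by rewrite /= s'E.
  - by rewrite word_perm_cons sE big_cons /letter_perm insubT.
  - by move=> z; rewrite inE => /orP[/eqP->|/fs'].
have size_s' : size s' = size s by rewrite -(size_map tag) -s'E !size_map.
rewrite sE; apply: vertex_word_free; rewrite ?size_s' //.
  exact: trace_reduced_reduced s'E rs.
by rewrite -size_eq0 size_s' size_eq0.
Qed.

Variables (d : R) (L : word).
Hypothesis d_ge0 : (0 <= d)%R.
Hypothesis phiM : forall v (g h : G v), letter g \in L -> letter h \in L ->
  eps_similar d (phi (g * h)) (phi g * phi h).

Lemma letter_permM v (g h : G v) : letter g \in L -> letter h \in L ->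
  eps_similar d (letter_perm (letter (g * h)))
    (letter_perm (letter g) * letter_perm (letter h)).
Proof.
move=> gL hL; rewrite /letter_perm /=; case: insub => [i|].
  by rewrite -[X in eps_similar _ _ X]lens_permM; apply: lens_perm_similar => //;
    apply: phiM.
by rewrite mulg1; apply: eps_similar_refl.
Qed.

(** Passing a commuting letter and stopping are exact; only a merge costs [d], and an insertion
    merges at most once. *)
Lemma word_perm_insert v (g : G v) s : letter g \in L -> {subset s <= L} ->
  eps_similar d (word_perm (insert g s)) (letter_perm (letter g) * word_perm s).
Proof.
move=> gL; elim: s => [_|x s IHs].
  by rewrite /= word_perm_push; apply: eps_similar_refl.
elim/letter_case: x => w h sL.
have {}IHs := IHs (fun y ys => sL y (mem_behead (s := _ :: _) ys)).
have hL := sL _ (mem_head _ _).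
rewrite word_perm_cons; have [wv|/negbTE wv] := eqVneq w v.
  rewrite wv in h hL {sL} *; rewrite insert_same word_perm_push mulgA.
  exact/eps_similarMr/letter_permM.
have [vw|/negbTE vw] := boolP (adjb v w).
  rewrite (insert_adj _ _ _ vw) word_perm_cons mulgA.
  rewrite (@letter_permC (letter g) (letter h) vw) -mulgA.
  exact: eps_similarMl.
rewrite (insert_far _ _ _ wv vw) word_perm_push word_perm_cons.
exact: eps_similar_refl.
Qed.

(** The condition on [drop k s] keeps every intermediate word within [L], where merging is
    controlled. *)
Lemma word_perm_act s t : {subset s <= L} ->
  (forall k, {subset act t (drop k s) <= L}) ->
  eps_similar ((size s)%:R * d) (word_perm (act t s)) (word_perm s * word_perm t).
Proof.
elim: s => [_ _|x s IHs sL actL].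
  by rewrite mul0r /word_perm big_nil mul1g; apply: eps_similar_refl.
have {}IHs := IHs (fun y ys => sL y (mem_behead (s := _ :: _) ys)) (fun k => actL k.+1).
elim/letter_case: x sL actL => v g sL actL; rewrite /= mulrS mulrDl mul1r.
apply: eps_similar_trans
  (_ : eps_similar _ _ (letter_perm (letter g) * word_perm (act t s))) _.
  apply: word_perm_insert; first exact/sL/mem_head.
  by have := actL 1%N; rewrite /= drop0.
by rewrite word_perm_cons -mulgA; apply: eps_similarMl.
Qed.

End GraphProductAction.

Theorem theorem1p1 (R : realType) (Gamma : simple_graph)
    (G : Gamma -> groupType) (soficG : forall v : Gamma, sofic R (G v)) :
  sofic R (graph_product G).
Proof.
move=> e e01 F /finite_seqP[fs FE].
have [e_gt0 e_lt1] := andP e01.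
pose nf := @normal_form Gamma G.
pose act := foldr (@insert_letter Gamma G).
(* The sum serves only as a common bound on the lengths. *)
pose n := sumn [seq size (nf z) | z <- fs].
have size_nf z : F z -> (size (nf z) <= n)%N.
  rewrite FE /= /n; elim: (fs) => //= z' s IHs; rewrite inE => /orP[/eqP<-|/IHs le_n].
    exact: leq_addr.
  exact: leq_trans le_n (leq_addl _ _).
(* All letters that occur while the product of two normal forms is reduced. *)
pose L := flatten [seq nf z | z <- fs] ++
  flatten [seq flatten [seq flatten [seq act (nf z2) (drop k (nf z1)) |
    k <- iota 0 n.+1] | z2 <- fs] | z1 <- fs].
have nfL z : F z -> {subset nf z <= L}.
  rewrite FE /= => zF x xz; rewrite mem_cat; apply/orP; left.
  by apply/flatten_mapP; exists z.
have actL z1 z2 k : F z1 -> F z2 -> {subset act (nf z2) (drop k (nf z1)) <= L}.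
  (* For larger [k] nothing remains of [nf z1], as for [k] equal to its length. *)
  move=> F1 F2 x; wlog le_k : k / (k <= n)%N => [IH|xk].
    have [|lt_k] := leqP k n; first exact: IH.
    rewrite drop_oversize -?[X in act _ X](drop_size (nf z1)); last first.
      exact: leq_trans (size_nf _ F1) (ltnW lt_k).
    exact/IH/size_nf.
  rewrite FE /= in F1 F2; rewrite mem_cat; apply/orP; right.
  apply/flatten_mapP; exists z1 => //; apply/flatten_mapP; exists z2 => //.
  by apply/flatten_mapP; exists k => //; rewrite mem_iota.
pose vs := [seq tag x | x <- L].
(* Letters at other vertices contribute the default element 1. *)
pose Fv v : set (G v) := [set` [seq tagged_as (letter (1 : G v)) x | x <- L]]%classic.
have FvL v (g : G v) : letter g \in L -> Fv v g.
  by move=> gL; apply/mapP; exists (letter g);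
    rewrite // (@tagged_asE _ G (letter 1) g).
(* At most [n] merges occur, with total cost at most [n * d]; the successor keeps the denominator
   positive. *)
pose d : R := (e / n.+1%:R)%R.
have n_gt0 : (0 < n.+1%:R :> R)%R by rewrite ltr0n.
have d_gt0 : (0 < d)%R by rewrite divr_gt0.
have d01 : (0 < d < 1)%R.
  rewrite d_gt0 /= ltr_pdivrMr // mul1r; apply: lt_le_trans e_lt1 _.
  by rewrite ler1n.
have [A [A_gt0 /= phiA]] :=
  common_quasi_action (F := Fv) vs d01 (fun v => finite_seq _) soficG.
(* The trivial map outside [vs] makes the unit and inverse laws hold at every vertex. *)
have phi_ex v : exists phi : G v -> {perm A},
    [/\ phi 1 = 1, forall g, (phi g)^-1 = phi g^-1 &
        v \in vs -> special_quasi_action (Fv v) d phi].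
  have [/phiA[phi phiP]|vvs] := boolP (v \in vs).
    by exists phi; split=> //; [apply: sqa1 phiP|apply: sqaV phiP].
  by exists (fun=> 1); split=> // _; rewrite invg1.
pose phi v := projT1 (cid (phi_ex v)).
have phiP v : [/\ phi v 1 = 1, forall g, (phi v g)^-1 = phi v g^-1 &
    v \in vs -> special_quasi_action (Fv v) d (phi v)].
  exact: projT2 (cid (phi_ex v)).
have phi1 v : phi v 1 = 1 by have [] := phiP v.
have phiV v g : (phi v g)^-1 = phi v g^-1 by have [] := phiP v.
have L_vs x : x \in L -> tag x \in vs by apply: map_f.
have phi_sqa x : x \in L -> special_quasi_action (Fv (tag x)) d (phi (tag x)).
  by move/L_vs; have [] := phiP (tag x).
have phiM v (g h : G v) : letter g \in L -> letter h \in L ->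
    eps_similar d (phi v (g * h)) (phi v g * phi v h).
  by move=> gL hL; apply: (sqaM (phi_sqa _ gL)); apply: FvL.
(* The colors lie in the cyclic group of order [#|A| + 1]; the successor provides the group
   structure on ordinals. *)
pose color (a : A) : 'I_#|A|.+1 := inord (enum_rank a).
have color_inj : injective color.
  move=> a b /(congr1 val); rewrite /= !inordK ?ltnS ?(ltnW (ltn_ord _)) //.
  by move/val_inj/enum_rank_inj.
pose wp := word_perm vs n color phi.
exists (gallery (seq_sub vs) A n 'I_#|A|.+1); split.
  have [a _] := card_gt0P A_gt0.
  by apply/card_gt0P; exists (1, [ffun=> a]).
exists (fun z => wp (nf z)); split.
- by rewrite /nf normal_form1 /wp /word_perm big_nil.
- move=> z; rewrite -word_permV //.
  exact/word_perm_shuffle/shuffle_sym/normal_formV.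
- move=> z Fz z1 b; apply/eqP; apply: word_perm_free => //.
  + exact: size_nf.
  + exact: reduced_normal_form.
  + by apply: contra_not_neq z1 => nfz; rewrite -(normal_formK z) -/(nf z) nfz.
  + elim/letter_case=> v g gz; have gL := nfL _ Fz _ gz; split; first exact: L_vs.
    move=> a; apply/eqP; apply: (sqa_free (phi_sqa _ gL)); first exact: FvL.
    by have := reduced_letter (reduced_normal_form z) gz; move/eqP.
- move=> z1 z2 F1 F2; rewrite /wp.
  rewrite (word_perm_shuffle vs n color phi (normal_formM z1 z2)).
  have := word_perm_act vs n color phi1 A_gt0 (ltW d_gt0) phiM
    (nfL _ F1) (fun k => actL _ _ k F1 F2).
  apply: eps_similar_le; rewrite /d mulrCA ger_pMr // ler_pdivrMr // mul1r ler_nat.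
  exact: leqW (size_nf _ F1).
Qed.
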